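(* Let $n\geq 2$ be an integer and let $\mathcal{C}_n=\operatorname{SPC}(n)\otimes\operatorname{SPC}(n)$. The maximum Hamming weight of a codeword in $\mathcal{C}_n$ is $$\max_{\mathbf{c}\in\mathcal{C}_n}\operatorname{wt}(\mathbf{c})=\begin{cases}n^2, & \text{if } n \text{ is even},\\ n^2-n, & \text{if } n\text{ is odd}.\end{cases}$$
   Context: For $n\geq 2$, $\operatorname{SPC}(n)=\{\mathbf{x}\in\mathbb{F}_2^n:\sum_{i=1}^{n}x_i=0\}$ is the binary single parity-check code of length $n$. For binary linear codes $C_1,C_2$ with generator matrices $G_1,G_2$, the product code $C_1\otimes C_2$ is the linear code generated by the Kronecker product $G_1\otimes G_2$. Arranging coordinates row by row, $\mathcal{C}_n=\operatorname{SPC}(n)\otimes\operatorname{SPC}(n)$ is the $\mathbb{F}_2$-linear space of all $n\times n$ matrices over $\mathbb{F}_2$ in which every row and every column has even Hamming weight. The Hamming weight $\operatorname{wt}$ of a matrix (or vector) is its number of nonzero entries. *)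

(* Defs.v *)
From HB Require Import structures.
From mathcomp Require Import all_boot all_order all_algebra.
From mathcomp Require Export mxtens.

Set Implicit Arguments.
Unset Strict Implicit.
Unset Printing Implicit Defensive.

Import GRing.Theory.
Local Open Scope ring_scope.

Definition wt (F : fieldType) (m n : nat) (A : 'M[F]_(m, n)) : nat :=
  #|[set ij : 'I_m * 'I_n | A ij.1 ij.2 != 0]|.

Definition code_of (F : fieldType) (k n : nat) (G : 'M[F]_(k, n)) :
    {vspace 'rV[F]_n} :=
  <<[seq row i G | i : 'I_k]>>%VS.

Definition generator_mx (F : fieldType) (k n : nat) (C : {vspace 'rV[F]_n})
    (G : 'M[F]_(k, n)) : bool :=
  row_free G && (code_of G == C).

Definition basis_mx (F : fieldType) (n : nat) (C : {vspace 'rV[F]_n}) :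
    'M[F]_(\dim C, n) :=
  \matrix_(i < \dim C) (vbasis C)`_i.

(* [tensmx] is the Kronecker product: the coordinate of index
   [mxtens_index (i, j)], with value [i * n2 + j], is the entry in row [i] and
   column [j] when a codeword is arranged row by row as an [n1 x n2] matrix.
   The choice of generator matrices is irrelevant, see [product_codeE]. *)
Definition product_code (F : fieldType) (n1 n2 : nat)
    (C1 : {vspace 'rV[F]_n1}) (C2 : {vspace 'rV[F]_n2}) :
    {vspace 'rV[F]_(n1 * n2)} :=
  code_of (basis_mx C1 *t basis_mx C2).

Definition parity_sum (n : nat) (x : 'rV['F_2]_n) : ('F_2)^o :=
  \sum_(i < n) x 0 i.

(* [linfun] is only meaningful on linear maps; see [mem_SPC]. *)
Definition SPC (n : nat) : {vspace 'rV['F_2]_n} :=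
  lker (linfun (@parity_sum n)).

Lemma parity_sum_is_linear (n : nat) : linear (@parity_sum n).
Proof.
move=> a x y; rewrite /parity_sum scaler_sumr -big_split /=.
by apply: eq_bigr => i _; rewrite !mxE.
Qed.

HB.instance Definition _ (n : nat) :=
  GRing.isLinear.Build 'F_2 'rV['F_2]_n ('F_2)^o *:%R (@parity_sum n)
    (@parity_sum_is_linear n).

Lemma mem_SPC (n : nat) (x : 'rV['F_2]_n) :
  (x \in SPC n) = (\sum_(i < n) x 0 i == 0).
Proof. by rewrite memv_ker lfunE. Qed.

Lemma mem_code_of (F : fieldType) (k n : nat) (G : 'M[F]_(k, n))
    (v : 'rV[F]_n) :
  (v \in code_of G) = (v <= G)%MS.
Proof.
apply/idP/idP => [|/submxP[u ->]].
  rewrite /code_of; set s := image _ _ => vs.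
  have {vs}: v \in <<in_tuple s>>%VS by [].
  move/coord_span => ->; apply: summx_sub => i _; apply: scalemx_sub.
  have: (in_tuple s)`_i \in s by apply: mem_nth.
  by case/imageP => j _ ->; apply: row_sub.
rewrite mulmx_sum_row; apply: memv_suml => i _; apply: memvZ.
by apply: memv_span; apply: image_f.
Qed.

Lemma basis_mx_generator (F : fieldType) (n : nat) (C : {vspace 'rV[F]_n}) :
  generator_mx C (basis_mx C).
Proof.
have rE i : row i (basis_mx C) = (vbasis C)`_i by rewrite rowK.
apply/andP; split.
  rewrite -kermx_eq0; apply/eqP/row_matrixP => i; rewrite row0.
  have: row i (kermx (basis_mx C)) *m basis_mx C = 0.
    by rewrite -row_mul mulmx_ker row0.
  rewrite mulmx_sum_row => e; apply/rowP => j; rewrite [RHS]mxE.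
  have/freeP fr : free (vbasis C) by apply/basis_free/vbasisP.
  apply: (fr (fun j => row i (kermx (basis_mx C)) 0 j)).
  by rewrite -[RHS]e; apply: eq_bigr => l _; rewrite rE.
rewrite -[X in _ == X](span_basis (vbasisP C)); apply/eqP; congr span.
apply: (@eq_from_nth _ 0); first by rewrite size_image card_ord size_tuple.
move=> i; rewrite size_image card_ord => lti.
by rewrite (nth_map (Ordinal lti)) ?size_enum_ord // rE nth_enum_ord.
Qed.

Lemma product_codeE (F : fieldType) (n1 n2 k1 k2 : nat)
    (C1 : {vspace 'rV[F]_n1}) (C2 : {vspace 'rV[F]_n2})
    (G1 : 'M[F]_(k1, n1)) (G2 : 'M[F]_(k2, n2)) :
  generator_mx C1 G1 -> generator_mx C2 G2 ->
  product_code C1 C2 = code_of (G1 *t G2).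
Proof.
have sub k l n (G : 'M[F]_(k, n)) (H : 'M[F]_(l, n)) :
    code_of G = code_of H -> (G <= H)%MS.
  move=> e; apply/row_subP => i.
  by rewrite -mem_code_of -e mem_code_of row_sub.
have tsub a b c d (G : 'M[F]_(a, n1)) (G' : 'M[F]_(b, n1))
    (H : 'M[F]_(c, n2)) (H' : 'M[F]_(d, n2)) :
    (G <= G')%MS -> (H <= H')%MS -> (G *t H <= G' *t H')%MS.
  by move=> /submxP[D ->] /submxP[D' ->]; rewrite -tensmx_mul submxMl.
move=> /andP[_ /eqP e1] /andP[_ /eqP e2].
have /andP[_ /eqP f1] := basis_mx_generator C1.
have /andP[_ /eqP f2] := basis_mx_generator C2.
apply/vspaceP => v; rewrite !mem_code_of.
by apply/idP/idP => /submx_trans -> //; apply: tsub; apply: sub;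
   rewrite ?e1 ?e2 ?f1 ?f2.
Qed.

(* Main.v *)
(** Every row of a codeword has even weight, hence weight at most [n - 1] when
    [n] is odd. The bounds are attained by the all-ones matrix J for [n] even,
    and by J + I for [n] odd; the latter is a codeword because it is the sum
    over [i] of [w_i *t w_i], where [w_i] is the all-ones vector with its
    [i]-th entry cleared, which has even weight [n - 1]. *)
Require Import Defs.
From mathcomp Require Import all_boot all_order all_algebra.

Set Implicit Arguments.
Unset Strict Implicit.
Unset Printing Implicit Defensive.

Import GRing.Theory.
Local Open Scope ring_scope.

Lemma wtE (F : fieldType) (m n : nat) (A : 'M[F]_(m, n)) :
  wt A = (\sum_(i < m) \sum_(j < n) (A i j != 0)%R)%N.
Proof.
rewrite /wt -sum1dep_card big_mkcond pair_bigA /=.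
by apply: eq_bigr => p _; case: (A _ _ != 0).
Qed.

Lemma wt_le (F : fieldType) (m n : nat) (A : 'M[F]_(m, n)) :
  (wt A <= m * n)%N.
Proof. by apply: leq_trans (max_card _) _; rewrite card_prod !card_ord. Qed.

Lemma F2_neq0 (x : 'F_2) : x != 0 -> x = 1.
Proof. by case: x => [[|[|k]] //= lt] _; apply: val_inj. Qed.

Lemma F2_natr_eq0 (k : nat) : (k%:R == 0 :> 'F_2) = ~~ odd k.
Proof. by rewrite -(dvdn_pcharf (pchar_Fp (isT : prime 2))) dvdn2. Qed.

(** Every nonzero entry over ['F_2] is 1, so the parity sum is the image of the weight in ['F_2];
    membership thus becomes the parity of a natural number. *)
Lemma mem_SPC_wt (n : nat) (x : 'rV['F_2]_n) : (x \in SPC n) = ~~ odd (wt x).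
Proof.
rewrite mem_SPC wtE big_ord1 -F2_natr_eq0 natr_sum; congr (_ == _).
apply: eq_bigr => j _; have [-> //|/F2_neq0 -> //] := eqVneq (x 0 j) 0.
Qed.

Definition tens_row (F : fieldType) (m n : nat) (c : 'rV[F]_(m * n))
  (i : 'I_m) : 'rV[F]_n := \row_j c 0 (mxtens_index (i, j)).

Lemma wt_tens_row (F : fieldType) (m n : nat) (c : 'rV[F]_(m * n)) :
  wt c = (\sum_(i < m) wt (tens_row c i))%N.
Proof.
rewrite wtE big_ord1 (reindex (@mxtens_index m n)) /=; last first.
  by exists (@mxtens_unindex m n) => ? _; rewrite ?mxtens_indexK ?mxtens_unindexK.
under [RHS]eq_bigr => i _ do rewrite wtE big_ord1.
rewrite pair_bigA /=; apply: eq_bigr => -[i j] _ /=; by rewrite mxE.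
Qed.

Lemma mem_basis_mx (F : fieldType) (n : nat) (C : {vspace 'rV[F]_n})
  (v : 'rV[F]_n) : (v \in C) = (v <= basis_mx C)%MS.
Proof.
have /andP[_ /eqP e] := basis_mx_generator C.
by rewrite -mem_code_of e.
Qed.

(** By the mixed-product rule, [(D *m G1) *t (D' *m G2)] equals [(D *t D') *m (G1 *t G2)], which
    lies in the row space of [G1 *t G2]. *)
Lemma tens_mem_product_code (F : fieldType) (m n : nat)
  (C1 : {vspace 'rV[F]_m}) (C2 : {vspace 'rV[F]_n}) (v : 'rV[F]_m)
  (w : 'rV[F]_n) :
  v \in C1 -> w \in C2 -> (v *t w : 'rV[F]_(m * n)) \in product_code C1 C2.
Proof.
rewrite /product_code mem_code_of !mem_basis_mx => /submxP[D ->] /submxP[D' ->].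
by rewrite -tensmx_mul submxMl.
Qed.

(** Entry [(i, j)] of [u *m (G1 *t G2)] is the sum over [k] and [l] of [u_(k,l) * G1 k i * G2 l j].
    For fixed [i], summing over [k] first leaves a combination of the rows of [G2] whose
    coefficients do not depend on [j]. *)
Lemma tens_row_mem (F : fieldType) (m n : nat)
  (C1 : {vspace 'rV[F]_m}) (C2 : {vspace 'rV[F]_n}) (c : 'rV[F]_(m * n))
  (i : 'I_m) :
  c \in product_code C1 C2 -> tens_row c i \in C2.
Proof.
rewrite /product_code mem_code_of => /submxP[u ->].
have -> : tens_row (u *m (basis_mx C1 *t basis_mx C2)) i =
    (\row_l \sum_k u 0 (mxtens_index (k, l)) * basis_mx C1 k i) *m basis_mx C2.
  apply/rowP => j; rewrite !mxE (reindex (@mxtens_index _ _)) /=; last first.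
    by exists (@mxtens_unindex _ _) => ? _;
       rewrite ?mxtens_indexK ?mxtens_unindexK.
  under [RHS]eq_bigr => l _ do rewrite mxE mulr_suml.
  rewrite exchange_big pair_bigA /=; apply: eq_bigr => -[k l] _ /=.
  by rewrite !mxE !mxtens_indexK /= mulrA.
by rewrite mem_basis_mx submxMl.
Qed.

Lemma wt_const1 (F : fieldType) (m n : nat) :
  wt (const_mx 1 : 'M[F]_(m, n)) = (m * n)%N.
Proof.
rewrite wtE; under eq_bigr => i _ do
  (under eq_bigr => j _ do rewrite mxE oner_neq0; rewrite sum1_card card_ord).
by rewrite sum_nat_const card_ord.
Qed.

Lemma sum_neq (n : nat) (i : 'I_n) : (\sum_(j < n) (j != i) = n.-1)%N.
Proof.
have := cardC1 i; rewrite card_ord => <-.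
by rewrite -sum1_card [RHS]big_mkcond; apply: eq_bigr => j _; rewrite inE; case: eqP.
Qed.

Definition punctured_ones (n : nat) (i : 'I_n) : 'rV['F_2]_n :=
  \row_j (j != i)%:R.

Lemma wt_punctured_ones (n : nat) (i : 'I_n) : wt (punctured_ones i) = n.-1.
Proof.
rewrite wtE big_ord1 -(sum_neq i); apply: eq_bigr => j _.
by rewrite mxE; case: (j != i).
Qed.

(** Entry [(k, l)] of the sum counts modulo 2 the indices [i] distinct from both [k] and [l]: there
    are [n - 1] of them if [k = l] and [n - 2] otherwise. For odd [n] the first number is even and
    the second odd. *)
Lemma sum_tens_punctured_ones (n : nat) (k : 'I_n) : odd n ->
  tens_row (\sum_i punctured_ones i *t punctured_ones i
              : 'rV['F_2]_(n * n)) k = punctured_ones k.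
Proof.
move=> n_odd; apply/rowP => l; rewrite !mxE summxE.
under eq_bigr => i _ do rewrite !mxE !mxtens_indexK /= -natrM mulnb.
rewrite -natr_sum.
have n0 : (0 < n)%N by case: n n_odd k l.
have n1_even : ~~ odd n.-1 by move: n_odd; rewrite -{1}(prednK n0).
have [->|neq_lk] := eqVneq l k.
  under eq_bigr => i _ do rewrite andbb eq_sym.
  by rewrite sum_neq; apply/eqP; rewrite F2_natr_eq0.
apply: F2_neq0; rewrite F2_natr_eq0 negbK.
(* Among the [n - 1] indices other than [k], setting [l] aside leaves the wanted count, so one plus
   that count is even. *)
have e := sum_neq k; rewrite (bigD1 l) //= neq_lk in e.
have -> : (\sum_i ((k != i) && (l != i)) = \sum_(i | i != l) (i != k))%N.
  rewrite [RHS]big_mkcond; apply: eq_bigr => i _.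
  by rewrite ![_ == i]eq_sym; case: (i != k); case: (i != l).
by move: n1_even; rewrite -e oddD /= negbK.
Qed.

Theorem proposition8 (n : nat) (hn : (2 <= n)%N) :
  (\max_(c in product_code (SPC n) (SPC n)) wt c
     = if odd n then n ^ 2 - n else n ^ 2)%N.
Proof.
apply/eqP; rewrite eqn_leq; apply/andP; split.
  apply/bigmax_leqP => c cC; case: ifP => [n_odd|_]; last first.
    by apply: leq_trans (wt_le _) _; rewrite mul1n.
  (* Writing the bound as a sum over rows lets the comparison be made row by row. *)
  have -> : (n ^ 2 - n = \sum_(i < n) n.-1)%N.
    by rewrite sum_nat_const card_ord -subn1 mulnBr muln1 mulnn.
  rewrite wt_tens_row; apply: leq_sum => i _.
  have := tens_row_mem i cC; rewrite mem_SPC_wt => row_even.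
  have : (wt (tens_row c i) <= n)%N by rewrite -[leqRHS]mul1n wt_le.
  (* A row of full weight [n] would have odd weight. *)
  rewrite leq_eqVlt => /predU1P[e|]; first by rewrite e n_odd in row_even.
  by move=> wt_lt; rewrite -ltnS prednK // ltnW.
case: ifP => [n_odd|n_even].
  set c : 'rV['F_2]_(n * n) :=
    \sum_i punctured_ones i *t punctured_ones i.
  have cC : c \in product_code (SPC n) (SPC n).
    (* Each summand is a tensor of two words of even weight [n - 1]. *)
    apply: memv_suml => i _; apply: tens_mem_product_code;
    by rewrite mem_SPC_wt wt_punctured_ones -subn1 oddB ?n_odd // ltnW.
  apply: (leq_trans _ (leq_bigmax_cond _ cC)).
  rewrite wt_tens_row; under eq_bigr => k _ do
    rewrite sum_tens_punctured_ones // wt_punctured_ones.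
  by rewrite sum_nat_const card_ord -mulnn -subn1 mulnBr muln1.
set j : 'rV['F_2]_n := const_mx 1.
have jC : j \in SPC n by rewrite mem_SPC_wt wt_const1 mul1n n_even.
(* The all-ones matrix is the pure tensor [j *t j], each of whose rows is [j]. *)
apply: (leq_trans _ (leq_bigmax_cond _ (tens_mem_product_code jC jC))).
rewrite wt_tens_row; under eq_bigr => k _.
  have -> : tens_row (j *t j : 'rV_(n * n)) k = j.
    by apply/rowP => l; rewrite !mxE mulr1.
  rewrite wt_const1 mul1n; over.
by rewrite sum_nat_const card_ord mulnn.
Qed.
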